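(* Let $G=(V,E)$ be a finite simple graph with $m=|E|$, $T$ its Hashimoto matrix on the $2m$ directed edges ($T_{(u,v),(x,y)}=1$ iff $v=x$ and $y\neq u$). Fix a reference orientation of the edges, let $D$ be the oriented incidence matrix ($D_{v,e}=+1$ if $v$ is the head of $e$, $-1$ if the tail, $0$ otherwise), $|D|$ its entrywise absolute value, $L=|D|^\top|D|-2I$, $S=D^\top D-2I$ ($I$ the $m\times m$ identity). Then, as an identity in $w$ (valid whenever $I-\tfrac w2L$ is invertible, in particular for all sufficiently small $|w|$), \[\det(I-wT)=\det\!\bigl(I-\tfrac w2L\bigr)\cdot C_G(w),\] where \[C_G(w)=\det\!\Bigl(I+\tfrac w2S+\tfrac{w^2}{4}D^\top|D|\bigl(I-\tfrac w2L\bigr)^{-1}|D|^\top D\Bigr).\]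
   Context: $\det(I-wT)$ is the reciprocal of the Ihara zeta function of $G$. $L$ is the line-graph adjacency matrix and $S$ the antisymmetric line-graph signed adjacency matrix. *)

(* Defs.v *)
From HB Require Import structures.
From mathcomp Require Import all_boot all_order all_algebra.

Set Implicit Arguments.
Unset Strict Implicit.
Unset Printing Implicit Defensive.

Import Order.TTheory GRing.Theory Num.Theory.
Local Open Scope ring_scope.

(* A finite simple graph G = (V, E) is given by its vertex type and its set   *)
(* of edges, each of which is a set of exactly two vertices.                  *)
Definition simple_graph (V : finType) (E : {set {set V}}) : Prop :=
  forall f, f \in E -> #|f| = 2%N.

(* The pair (u, v) is the directed edge from the tail u to the head v. For a  *)
(* simple graph, [set u; v] \in E forces u != v.                              *)
Definition arcs (V : finType) (E : {set {set V}}) : {set V * V} :=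
  [set a | [set a.1; a.2] \in E].

(* The values of o outside E are irrelevant.                                  *)
Definition orientation (V : finType) (E : {set {set V}})
    (o : {set V} -> V * V) : Prop :=
  forall f, f \in E -> f = [set (o f).1; (o f).2].

Section Matrices.
Variables (K : numFieldType) (V : finType) (E : {set {set V}}).
Variable o : {set V} -> V * V.

(* Rows and columns are numbered by the canonical enumerations of V, E and    *)
(* arcs E.                                                                    *)
Definition hashimoto : 'M[K]_#|arcs E| :=
  \matrix_(i, j)
    let: (u, v) := enum_val i in let: (x, y) := enum_val j in
    if (v == x) && (y != u) then 1 else 0.

Definition incidence : 'M[K]_(#|V|, #|E|) :=
  \matrix_(i, j)
    let v := enum_val i in let: (t, h) := o (enum_val j) in
    if v == h then 1 else if v == t then -1 else 0.

Definition abs_incidence : 'M[K]_(#|V|, #|E|) := map_mx Num.norm incidence.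

Definition line_adj : 'M[K]_#|E| := abs_incidence^T *m abs_incidence - 2%:M.

Definition line_signed : 'M[K]_#|E| := incidence^T *m incidence - 2%:M.

Definition correction (w : K) : K :=
  \det (1%:M + (w / 2) *: line_signed
        + (w ^+ 2 / 4) *: (incidence^T *m abs_incidence
            *m invmx (1%:M - (w / 2) *: line_adj) *m abs_incidence^T *m incidence)).

End Matrices.

(* Main.v *)
(* Listing the arcs as the m oriented edges followed by their m reverses turns
   T into a 2 x 2 block matrix. Conjugating by [[1, 1], [1, -1]] splits arc
   functions into symmetric and antisymmetric parts and gives
   2 T ~ [[L, - |D|^T D], [D^T |D|, - S]];
   the formula is then the Schur complement of the block I - (w/2) L. *)
Require Import Defs.
From HB Require Import structures.
From mathcomp Require Import all_boot all_order all_algebra.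
From mathcomp Require Import perm ring.

Set Implicit Arguments.
Unset Strict Implicit.
Unset Printing Implicit Defensive.

Import Order.TTheory GRing.Theory Num.Theory.
Local Open Scope ring_scope.

(** * Determinants and invertibility of matrices *)

Lemma det_mxsub_bij (R : comNzRingType) (n p : nat) (f : 'I_p -> 'I_n)
    (A : 'M[R]_n) : bijective f -> \det (mxsub f f A) = \det A.
Proof.
(* The two sizes are equal only by counting, as for [#|E| + #|E|] and [#|arcs E|] later. Once they
   are identified, [f] is a permutation acting on both rows and columns, and its sign cancels. *)
move=> f_bij; have eq_np: p = n by rewrite -[p]card_ord (bij_eq_card f_bij) card_ord.
subst p; pose s := perm (bij_inj f_bij).
have -> : mxsub f f A = row_perm s (col_perm s A).
  by apply/matrixP=> i j; rewrite !mxE !permE.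
rewrite row_permE col_permE !det_mulmx !det_perm mulrCA -signr_addb.
by rewrite odd_permV addbb mulr1.
Qed.

Lemma det_block_schur (F : fieldType) (n p : nat) (A : 'M[F]_n)
    (B : 'M[F]_(n, p)) (C : 'M[F]_(p, n)) (D : 'M[F]_p) : A \in unitmx ->
  \det (block_mx A B C D) = \det A * \det (D - C *m invmx A *m B).
Proof.
move=> uA; have -> : block_mx A B C D
    = block_mx 1%:M 0 (C *m invmx A) 1%:M *m block_mx A B 0 (D - C *m invmx A *m B).
  by rewrite mulmx_block !mul1mx !mul0mx !addr0 mulmxKV // addrC subrK.
by rewrite det_mulmx det_lblock det_ublock !det1 !mul1r.
Qed.

(** The matrix [P] squares to twice the identity, so its half [Q] is its inverse, and the block
    matrix on the right is the conjugate of the one on the left by [P]. *)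
Lemma det_block_sym_antisym (F : fieldType) (n : nat) (A B C D : 'M[F]_n) :
    (2 : F) != 0 ->
  \det (block_mx A B C D)
    = \det (block_mx (2^-1 *: (A + B + C + D)) (2^-1 *: (A - B + C - D))
                     (2^-1 *: (A + B - C - D)) (2^-1 *: (A - B - C + D))).
Proof.
move=> nz2; pose P : 'M[F]_(n + n) := block_mx 1%:M 1%:M 1%:M (- 1%:M).
pose Q : 'M[F]_(n + n) := 2^-1 *: P.
have PQ : P *m Q = 1%:M.
  rewrite -scalemxAr mulmx_block !mul1mx !mulmx1 mulmxN mulmx1 opprK subrr.
  rewrite scale_block_mx !scaler0 -mulr2n -scaler_nat scalerA mulVf // scale1r.
  by rewrite -scalar_mx_block.
have -> : block_mx (2^-1 *: (A + B + C + D)) (2^-1 *: (A - B + C - D))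
    (2^-1 *: (A + B - C - D)) (2^-1 *: (A - B - C + D))
    = P *m block_mx A B C D *m Q.
  rewrite -scalemxAr !mulmx_block !mulNmx !mulmxN !mul1mx !mulmx1 scale_block_mx.
  by congr block_mx; congr (_ *: _); apply/matrixP=> i j; rewrite !mxE; ring.
by rewrite !det_mulmx mulrAC -det_mulmx PQ det1 mul1r.
Qed.

(* A row x with x = w x M satisfies |x|_1 <= |w| |M| |x|_1, where |M| is the
   sum of the norms of the entries; this needs no maximum, which the partial
   order of K might not provide. *)
Lemma unitmx_1_sub_small (K : numFieldType) (n : nat) (M : 'M[K]_n) :
  exists2 eps : K, 0 < eps &
    forall w : K, `|w| < eps -> 1%:M - w *: M \in unitmx.
Proof.
pose c := \sum_i \sum_j `|M i j| : K.
have c_ge0 : 0 <= c by apply: sumr_ge0 => i _; apply: sumr_ge0.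
have c1_gt0 : 0 < c + 1 by rewrite ltr_wpDl.
(* The [+ 1] keeps the radius meaningful when [M] is zero, and still forces [|w| * c < 1]. *)
exists (c + 1)^-1; first by rewrite invr_gt0.
move=> w w_small; rewrite -row_free_unit -kermx_eq0; apply/rowV0P => x /sub_kermxP.
rewrite mulmxBr mulmx1 -scalemxAr => /eqP; rewrite subr_eq0 => /eqP xE.
pose N := \sum_i `|x 0 i|.
have N_ge0 : 0 <= N by apply: sumr_ge0.
have N_le : N <= `|w| * (c * N).
  have Mx_le i : `|x 0 i| <= `|w| * \sum_j `|x 0 j| * `|M j i|.
    rewrite {1}xE !mxE normrM ler_wpM2l //.
    apply: le_trans (ler_norm_sum _ _ _) _.
    by apply: ler_sum => j _; rewrite normrM.
  apply: le_trans (ler_sum _ (fun i _ => Mx_le i)) _.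
  (* After the exchange, the row sum of norms of row [j] of [M] is weighted by [|x 0 j|], which is
     at most [N]. *)
  rewrite -mulr_sumr ler_wpM2l // exchange_big /= /c mulr_suml.
  apply: ler_sum => j _; rewrite -mulr_sumr mulrC ler_wpM2l ?sumr_ge0 //.
  by rewrite /N (bigD1 j) //= lerDl sumr_ge0.
have N0 : N = 0.
  apply/eqP; apply: contraT => N_neq0.
  have N_gt0 : 0 < N by rewrite lt_def N_neq0.
  move: N_le; rewrite mulrA -{1}[N]mul1r ler_pM2r // => w_big.
  rewrite -(ltxx (1 : K)); apply: le_lt_trans w_big _.
  have w_lt1 : `|w| * (c + 1) < 1 by rewrite -ltr_pdivlMr // div1r.
  by apply: le_lt_trans w_lt1; rewrite ler_wpM2l // lerDl.
apply/rowP=> i; rewrite mxE; apply/normr0_eq0.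
by move/eqP: N0; rewrite psumr_eq0 // => /allP/(_ i (mem_index_enum _))/eqP.
Qed.

Lemma set2_eq (T : finType) (a b c d : T) :
  [set a; b] = [set c; d] -> (a, b) = (c, d) \/ (a, b) = (d, c).
Proof.
move=> eq_set.
have /set2P a_in : a \in [set c; d] by rewrite -eq_set set21.
have /set2P b_in : b \in [set c; d] by rewrite -eq_set set22.
have /set2P c_in : c \in [set a; b] by rewrite eq_set set21.
have /set2P d_in : d \in [set a; b] by rewrite eq_set set22.
case: a_in b_in c_in d_in => aE [] bE [] cE [] dE;
  first [left; congruence | right; congruence].
Qed.

(** With [H] and [T] the matrices of heads and tails, D = H - T and |D| = H + T. All matrices of the
    theorem thus reduce to products such as H^T T, whose entries test whether two endpoints
    coincide. *)
Definition endpoint_mx (K : numFieldType) (V : finType) (n : nat)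
    (p : 'I_n -> V) : 'M[K]_(#|V|, n) :=
  \matrix_(i, j) (enum_val i == p j)%:R.

Lemma mul_endpoint_mx (K : numFieldType) (V : finType) (n : nat)
    (p q : 'I_n -> V) (i j : 'I_n) :
  ((endpoint_mx K p)^T *m endpoint_mx K q) i j = (p i == q j)%:R.
Proof.
rewrite mxE (bigD1 (enum_rank (p i))) //= !mxE enum_rankK eqxx mul1r big1 ?addr0 //.
move=> k /negPf kNp; rewrite !mxE.
have -> : (enum_val k == p i) = false.
  by apply: contraFF kNp => /eqP <-; rewrite enum_valK.
by rewrite mul0r.
Qed.

Section Graph.
Variables (K : numFieldType) (V : finType) (E : {set {set V}}).
Variable o : {set V} -> V * V.
Hypotheses (hG : simple_graph E) (ho : orientation E o).

(** * Endpoints of edges and the incidence matrices *)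

Definition tail (e : 'I_#|E|) : V := (o (enum_val e)).1.
Definition head (e : 'I_#|E|) : V := (o (enum_val e)).2.

Lemma edgeE (e : 'I_#|E|) : enum_val e = [set tail e; head e].
Proof. exact/ho/enum_valP. Qed.

Lemma tail_neq_head (e : 'I_#|E|) : tail e != head e.
Proof.
by have := hG (enum_valP e); rewrite edgeE cards2; case: (_ != _).
Qed.

Lemma edge_inj (e f : 'I_#|E|) :
  [set tail e; head e] = [set tail f; head f] -> e = f.
Proof. by rewrite -!edgeE => /enum_val_inj. Qed.

Lemma incidenceE :
  incidence K E o = endpoint_mx K head - endpoint_mx K tail.
Proof.
apply/matrixP=> i e; rewrite !mxE.
move: (tail_neq_head e); rewrite /tail /head; case: (o _) => t h /= t_neq_h.
have [-> | _] := eqVneq (enum_val i) h; first by rewrite eq_sym (negPf t_neq_h) subr0.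
by case: (_ == t); rewrite ?subr0 ?sub0r.
Qed.

(** Since tail and head differ, no entry of H - T receives both a 1 and a -1, so the norm only flips
    the sign of the tail part. *)
Lemma abs_incidenceE :
  abs_incidence K E o = endpoint_mx K head + endpoint_mx K tail.
Proof.
apply/matrixP=> i e; rewrite /abs_incidence incidenceE !mxE.
move: (tail_neq_head e).
have [-> | _] := eqVneq (enum_val i) (head e); last first.
  by rewrite sub0r add0r normrN normr_nat.
by rewrite eq_sym => /negPf->; rewrite subr0 addr0 normr1.
Qed.

(** * Listing the arcs as oriented edges and their reverses *)

Definition signed_arc (k : 'I_(#|E| + #|E|)) : V * V :=
  match split k with
  | inl e => (tail e, head e)
  | inr e => (head e, tail e)
  end.

Lemma signed_arc_lshift (e : 'I_#|E|) :
  signed_arc (lshift #|E| e) = (tail e, head e).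
Proof. by rewrite /signed_arc (unsplitK (inl e)). Qed.

Lemma signed_arc_rshift (e : 'I_#|E|) :
  signed_arc (rshift #|E| e) = (head e, tail e).
Proof. by rewrite /signed_arc (unsplitK (inr e)). Qed.

Lemma signed_arc_in (k : 'I_(#|E| + #|E|)) : signed_arc k \in arcs E.
Proof.
rewrite inE /signed_arc; case: (split k) => e /=; first by rewrite -edgeE enum_valP.
by rewrite setUC -edgeE enum_valP.
Qed.

Lemma signed_arc_inj : injective signed_arc.
Proof.
move=> k l; rewrite -[k]splitK -[l]splitK.
case: (split k) => e; case: (split l) => f /=;
  rewrite ?signed_arc_lshift ?signed_arc_rshift => -[eq1 eq2].
- by rewrite (@edge_inj e f) // eq1 eq2.
(* If an oriented edge coincided with a reversed one, both would come from the same edge, whose tail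
   would then equal its head. *)
- have ef : e = f by apply: edge_inj; rewrite eq1 eq2 setUC.
  by move: (tail_neq_head f); rewrite -{1}ef eq1 eqxx.
- have ef : e = f by apply: edge_inj; rewrite eq1 eq2 setUC.
  by move: (tail_neq_head f); rewrite -{2}ef eq1 eqxx.
- by rewrite (@edge_inj e f) // eq1 eq2.
Qed.

Lemma signed_arc_surj (a : V * V) :
  a \in arcs E -> exists k, signed_arc k = a.
Proof.
case: a => u v; rewrite inE /= => uvE.
pose e := enum_rank_in uvE [set u; v].
have /set2_eq[] : [set u; v] = [set tail e; head e].
- by rewrite -edgeE enum_rankK_in.
- by move=> ->; exists (lshift _ e); rewrite signed_arc_lshift.
- by move=> ->; exists (rshift _ e); rewrite signed_arc_rshift.
Qed.

Definition arc_rank (k : 'I_(#|E| + #|E|)) : 'I_#|arcs E| :=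
  enum_rank_in (signed_arc_in k) (signed_arc k).

Lemma arc_rankK (k : 'I_(#|E| + #|E|)) : enum_val (arc_rank k) = signed_arc k.
Proof. by rewrite enum_rankK_in // signed_arc_in. Qed.

Lemma arc_rank_bij : bijective arc_rank.
Proof.
(* Surjectivity gives a right inverse by finite choice; injectivity makes it two-sided. *)
have [|g gK] := @fin_all_exists _ _ (fun i k => arc_rank k = i).
  move=> i; have [k kE] := signed_arc_surj (enum_valP i).
  by exists k; apply: enum_val_inj; rewrite arc_rankK.
exists g => //; apply: inj_can_sym gK _ => k l /(congr1 enum_val).
by rewrite !arc_rankK => /signed_arc_inj.
Qed.

(** * The Hashimoto matrix in block form *)

Let H := endpoint_mx K head.
Let T := endpoint_mx K tail.

(** Between two arcs of the same half, backtracking is impossible: it would make them one edge with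
    equal ends ([nloop]). Between opposite halves, an arc backtracks exactly onto its own reverse
    ([eq_edge]), so the identity is subtracted there. *)
Lemma hashimoto_block :
  mxsub arc_rank arc_rank (hashimoto K E)
    = block_mx (H^T *m T) (H^T *m H - 1%:M) (T^T *m T - 1%:M) (T^T *m H).
Proof.
have eq_edge (e f : 'I_#|E|) (p q : 'I_#|E| -> V) :
    (forall e, [set p e; q e] = [set tail e; head e]) ->
    (p e == p f) && (q f == q e) = (e == f).
  move=> pq; apply/andP/eqP => [[/eqP pE /eqP qE] | ->]; last by rewrite !eqxx.
  by apply: edge_inj; rewrite -!pq pE qE.
have nloop (e f : 'I_#|E|) : head e = tail f -> head f = tail e -> False.
  move=> he hf; have ef : e = f by apply: edge_inj; rewrite he hf setUC.
  by move: (tail_neq_head f); rewrite -he ef eqxx.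
apply/matrixP=> i j; rewrite -[i]splitK -[j]splitK.
case: (split i) => e; case: (split j) => f /=;
  rewrite ?block_mxEul ?block_mxEur ?block_mxEdl ?block_mxEdr [LHS]mxE mxE.
all: rewrite !arc_rankK ?signed_arc_lshift ?signed_arc_rshift.
- rewrite mul_endpoint_mx; case: eqP => //= he; case: eqP => //= hf.
  by case: (nloop e f).
- rewrite [RHS]mxE mul_endpoint_mx !mxE -(eq_edge e f head tail); last by move=> ?; rewrite setUC.
  by do 2!case: (_ == _); rewrite ?subr0 ?subrr.
- rewrite [RHS]mxE mul_endpoint_mx !mxE -(eq_edge e f tail head) //.
  by do 2!case: (_ == _); rewrite ?subr0 ?subrr.
- rewrite mul_endpoint_mx; case: eqP => //= te; case: eqP => //= tf.
  by case: (nloop f e).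
Qed.

Lemma det_hashimoto (w : K) :
  \det (1%:M - w *: hashimoto K E)
  = \det (block_mx (1%:M - (w / 2) *: line_adj K E o)
      ((w / 2) *: ((abs_incidence K E o)^T *m incidence K E o))
      (- ((w / 2) *: ((incidence K E o)^T *m abs_incidence K E o)))
      (1%:M + (w / 2) *: line_signed K E o)).
Proof.
rewrite -(det_mxsub_bij _ arc_rank_bij).
have -> : mxsub arc_rank arc_rank (1%:M - w *: hashimoto K E)
    = 1%:M - w *: mxsub arc_rank arc_rank (hashimoto K E).
  apply/matrixP=> i j; rewrite !mxE; congr (_%:R - _).
  by rewrite (inj_eq (bij_inj arc_rank_bij)).
rewrite hashimoto_block scalar_mx_block scale_block_mx opp_block_mx add_block_mx.
have nz2 : (2 : K) != 0 by rewrite pnatr_eq0.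
rewrite (det_block_sym_antisym _ _ _ _ nz2).
rewrite /line_adj /line_signed incidenceE abs_incidenceE -/H -/T.
have trD : (H + T)^T = H^T + T^T by rewrite raddfD.
have trB : (H - T)^T = H^T - T^T by rewrite raddfB.
rewrite trD trB !(mulmxDl, mulNmx, mulmxDr, mulmxN).
(* With the four products opaque, each block is a linear identity between entries. The two
   subtracted identities of [hashimoto_block] add up to the 2I in both L and S. *)
move: (H^T *m H) (H^T *m T) (T^T *m H) (T^T *m T) => HH HT TH TT.
by congr (\det (block_mx _ _ _ _)); apply/matrixP=> i j; rewrite !mxE; field.
Qed.

End Graph.

Theorem theorem5p2 (K : numFieldType) (V : finType) (E : {set {set V}})
    (o : {set V} -> V * V) (hG : simple_graph E) (ho : orientation E o) :
  (forall w : K, 1%:M - (w / 2) *: line_adj K E o \in unitmx ->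
     \det (1%:M - w *: hashimoto K E)
       = \det (1%:M - (w / 2) *: line_adj K E o) * correction E o w)
  /\ (exists2 eps : K, 0 < eps &
        forall w : K, `|w| < eps ->
          1%:M - (w / 2) *: line_adj K E o \in unitmx).
Proof.
split=> [w uL | ].
  rewrite (det_hashimoto hG ho) det_block_schur //; congr (_ * \det (_ + _)).
  (* The minus sign of the lower left block cancels the one of the Schur complement, and the two
     factors w/2 combine into w^2/4. *)
  rewrite !mulNmx opprK -!scalemxAl -!scalemxAr scalerA !mulmxA.
  by congr (_ *: _); field.
(* The factor 1/2 is absorbed into the matrix so that the bound concerns [w] itself. *)
have [eps eps_gt0 uM] := unitmx_1_sub_small (2^-1 *: line_adj K E o).
by exists eps => // w /uM; rewrite scalerA.
Qed.
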